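(* Let $\alpha>1$ be real. The online greedy algorithm for splittable online routing with speed scalable network elements is $\alpha^\alpha$-competitive: for every instance and every run of the greedy algorithm, if $\widetilde f(p)$ denotes the final amount of flow routed on path $p$, then $$\sum_e\Big(\sum_j\sum_{p\in P_j:\,p\ni e}\widetilde f(p)\Big)^\alpha\;\le\;\alpha^\alpha\cdot\mathrm{OPT},$$ where $\mathrm{OPT}$ is the minimum of $\sum_e\big(\sum_j\sum_{p\in P_j:\,p\ni e}f(p)\big)^\alpha$ over all nonnegative $f$ with $\sum_{p\in P_j}f(p)\ge f_j$ for every request $j$.
   Context: An instance consists of a finite graph with edge set $E$ and a sequence of requests $j=1,\dots,n$ arriving one by one; request $j$ has a source $s_j$, a sink $t_j\ne s_j$ and a flow requirement $f_j>0$. $P_j$ is the (nonempty, finite) set of simple $(s_j,t_j)$-paths, each regarded as a set of edges; the sets $P_j$ for different $j$ are treated as disjoint (each path is labelled by its request). In the splittable version, when request $j$ arrives the algorithm must irrevocably choose $f(p)\ge 0$ for $p\in P_j$ with $\sum_{p\in P_j}f(p)=f_j$. The load of edge $e$ is the total flow on all paths (of all requests) containing $e$; an edge with load $\ell$ uses power $\ell^\alpha$, and the objective is the total power $\sum_e(\text{load of }e)^\alpha$. Online greedy algorithm: to route request $j$, flow is continuously routed along $(s_j,t_j)$-paths $p$ that currently minimize $\sum_{e\in p}\alpha\,(\text{current load of }e)^{\alpha-1}$, until the requirement is met; the current load counts all flow sent so far, for earlier requests and for request $j$ itself. Formally, the flow for request $j$ is described by nondecreasing Lipschitz functions $\tau\mapsto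 f_\tau(p)$, $p\in P_j$, $\tau\in[0,f_j]$, with $f_0(p)=0$ and $\sum_{p\in P_j}f_\tau(p)=\tau$, such that for almost every $\tau$, if $\frac{d}{d\tau}f_\tau(p)>0$ then $p$ minimizes $\sum_{e\in p}\alpha L_\tau(e)^{\alpha-1}$ over $P_j$, where $L_\tau(e)$ is the load of $e$ from the requests before $j$ plus $\sum_{p\in P_j:\,p\ni e}f_\tau(p)$. The final flow is $\widetilde f(p)=f_{f_j}(p)$. A run of the algorithm is any choice of such functions for all requests in order. *)

(* Defs.v *)
From HB Require Import structures.
From mathcomp Require Import all_boot all_order all_algebra.
From mathcomp Require Import all_classical all_reals all_analysis.

Set Implicit Arguments.
Unset Strict Implicit.
Unset Printing Implicit Defensive.

Import Order.TTheory GRing.Theory Num.Theory.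
Import numFieldNormedType.Exports.
Local Open Scope classical_set_scope.
Local Open Scope ring_scope.

(* Undirected graphs; parallel edges and loops are allowed (a loop has a
   singleton as its set of ends), and simple graphs are a special case. *)
Record graph := Graph {
  vertex : finType;
  edge : finType;
  ends : edge -> {set vertex};
  ends_card : forall e, (0 < #|ends e| <= 2)%N }.

(* A walk from x is the sequence of its steps: the edge taken together with
   the vertex it leads to. *)
Fixpoint walk (G : graph) (x : vertex G) (w : seq (edge G * vertex G)) : bool :=
  if w is (e, y) :: w' then (ends e == [set x; y])%SET && walk y w' else true.

Definition simple_path (G : graph) (s t : vertex G)
    (w : seq (edge G * vertex G)) : bool :=
  [&& walk s w, last s (unzip2 w) == t & uniq (s :: unzip2 w)].

Definition paths (G : graph) (s t : vertex G) : {set {set edge G}} :=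
  [set p : {set edge G} |
    `[< exists2 w, simple_path s t w & p = [set e in unzip1 w]%SET >]]%SET.

(* The requests arrive in the order of the indices in 'I_nreq. *)
Record instance (R : realType) := Instance {
  igraph : graph;
  nreq : nat;
  src : 'I_nreq -> vertex igraph;
  snk : 'I_nreq -> vertex igraph;
  dem : 'I_nreq -> R;
  snk_neq_src : forall j, snk j != src j;
  dem_gt0 : forall j, 0 < dem j;
  paths_gt0 : forall j, (0 < #|paths (src j) (snk j)|)%N }.

Section Routing.
Variables (R : realType) (I : instance R).

Definition rpaths (j : 'I_(nreq I)) : {set {set edge (igraph I)}} :=
  paths (src j) (snk j).

(* f j p is the flow of request j on p; it is only meaningful for p in
   rpaths j. Indexing by j makes the path sets of the requests disjoint. *)
Definition flow := 'I_(nreq I) -> {set edge (igraph I)} -> R.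

Definition load (f : flow) (e : edge (igraph I)) : R :=
  \sum_(j < nreq I) \sum_(p in rpaths j | e \in p) f j p.

Definition power (alpha : R) (f : flow) : R :=
  \sum_(e : edge (igraph I)) load f e `^ alpha.

Definition feasible (f : flow) : Prop :=
  forall j, (forall p, p \in rpaths j -> 0 <= f j p) /\
            dem j <= \sum_(p in rpaths j) f j p.

(* This infimum is a minimum: see OPT_attained. *)
Definition OPT (alpha : R) : R := inf [set power alpha f | f in feasible].

(* g j p tau is the flow sent on p for request j once a total amount tau has
   been routed for j; it is only meaningful for 0 <= tau <= dem j. *)
Definition schedule := 'I_(nreq I) -> {set edge (igraph I)} -> R -> R.

Definition final_flow (g : schedule) : flow := fun j p => g j p (dem j).

Definition current_load (g : schedule) (j : 'I_(nreq I)) (tau : R)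
    (e : edge (igraph I)) : R :=
  \sum_(i < nreq I | (i < j)%N)
     \sum_(p in rpaths i | e \in p) final_flow g i p
  + \sum_(p in rpaths j | e \in p) g j p tau.

Definition path_cost (alpha : R) (g : schedule) (j : 'I_(nreq I)) (tau : R)
    (p : {set edge (igraph I)}) : R :=
  \sum_(e in p) alpha * current_load g j tau e `^ (alpha - 1).

(* derive1 has a junk value where the derivative does not exist, hence the
   explicit derivability premise. *)
Definition greedy_run (alpha : R) (g : schedule) : Prop :=
  forall j : 'I_(nreq I),
    [/\ forall p, p \in rpaths j ->
          [/\ g j p 0 = 0,
              {in `[0, dem j] &, {homo g j p : x y / x <= y}} &
              exists k : R, k.-lipschitz_(`[0, dem j]) (g j p)],
        forall tau, tau \in `[0, dem j] ->
          \sum_(p in rpaths j) g j p tau = tau &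
        {ae (@lebesgue_measure R), forall tau : R, tau \in `]0, dem j[ ->
          forall p, p \in rpaths j ->
            derivable (g j p) tau 1 -> 0 < derive1 (g j p) tau ->
            forall q, q \in rpaths j ->
              path_cost alpha g j tau p <= path_cost alpha g j tau q}].

End Routing.

Lemma continuous_powR_max0 (R : realType) (alpha : R) : 0 < alpha ->
  continuous (fun x : R => Num.max x 0 `^ alpha).
Proof.
move=> a0 x; have [xlt0|xgt0|->] := ltgtP x 0.
- rewrite /continuous_at (max_idPr (ltW xlt0)).
  apply: cvg_near_cst; near=> y; rewrite (max_idPr _)//.
  by apply/ltW; near: y; exact: lt_nbhsl.
- rewrite /continuous_at (max_idPl (ltW xgt0)).
  apply: (@cvg_trans _ ((fun y => y `^ alpha) @ x)).
    apply: near_eq_cvg; near=> y; rewrite (max_idPl _)//.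
    by apply/ltW; near: y; exact: lt_nbhsr.
  suff: {for x, continuous (fun y : R => y `^ alpha)} by [].
  apply: differentiable_continuous; apply/derivable1_diffP.
  by apply: derivable_powR; rewrite in_itv/= andbT.
- rewrite /continuous_at maxxx powR0 ?gt_eqF//.
  apply/cvgrPdist_lt => e e0.
  have d0 : 0 < e `^ alpha^-1 by exact: powR_gt0.
  near=> y.
  rewrite sub0r normrN ger0_norm ?powR_ge0//.
  have -> : e = (e `^ alpha^-1) `^ alpha.
    by rewrite -powRrM mulVf ?gt_eqF// powRr1// ltW.
  rewrite gt0_ltr_powR ?nnegrE ?le_max ?lexx ?orbT ?(ltW d0)//.
  rewrite gt_max d0 andbT.
  by near: y; exact: lt_nbhsl.
Unshelve. all: end_near. Qed.

Section Attained.
Variables (R : realType) (I : instance R).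

Lemma continuous_bigsum (T : topologicalType) (J : Type) (r : seq J)
    (P : pred J) (F : J -> T -> R) :
  (forall i, continuous (F i)) ->
  continuous (fun x => \sum_(i <- r | P i) F i x).
Proof.
move=> cF; elim: r => [|i r IHr] x.
  by under eq_fun do rewrite big_nil; exact: cst_continuous.
under eq_fun do rewrite big_cons.
by case: (P i); [apply: continuousD; [exact: cF|exact: IHr]|exact: IHr].
Qed.

Lemma load_ge0 (f : flow I) e :
  (forall j p, p \in rpaths j -> 0 <= f j p) -> 0 <= load f e.
Proof.
by move=> f0; apply: sumr_ge0 => j _; apply: sumr_ge0 => p /andP[pj _]; exact: f0.
Qed.

Lemma OPT_attained (alpha : R) : 0 < alpha ->
  exists2 f : flow I, feasible f & power alpha f = OPT I alpha.
Proof.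
move=> a0.
pose X := prod_topology (fun _ : ('I_(nreq I) * {set edge (igraph I)})%type => R).
pose cur (u : X) : flow I := fun j p => u (j, p).
pose B : set X := [set u | forall i, `[0, dem i.1]%classic (u i)].
pose K : set X := B `&`
  \bigcap_j [set u | dem j <= \sum_(p in rpaths j) u (j, p)].
have cptB : compact B.
  by apply: (@tychonoff _ (fun _ => R) (fun i => `[0, dem i.1]%classic)) => i;
    exact: segment_compact.
have cproj i : continuous (fun u : X => u i : R).
  exact: (@proj_continuous _ (fun _ => R) i).
have cptK : compact K.
  apply: compact_closedI => //.
  apply: closed_bigI => j _.
  apply: (@preimage_closed _ _ (fun u : X => \sum_(p in rpaths j) u (j, p))
            [set x : R | dem j <= x]); last exact: closed_ge.
  by move=> u _; apply: continuous_bigsum => p; exact: cproj.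
have feasK u : K u -> feasible (cur u).
  move=> [Bu Du] j; split; last exact: Du.
  by move=> p _; have := Bu (j, p); rewrite /= in_itv/= => /andP[].
have trunc (f : flow I) : feasible f -> exists2 u : X, K u & power alpha (cur u) <= power alpha f.
  move=> ff.
  pose u : X := fun i => if i.2 \in rpaths i.1 then Num.min (f i.1 i.2) (dem i.1) else 0.
  have Ku : K u.
    split=> [i|j _] /=.
      rewrite /= in_itv/= /u; case: ifPn => [pi|_]; last first.
        by rewrite lexx ltW ?dem_gt0.
      by rewrite le_min (ff i.1).1// (ltW (dem_gt0 _)) ge_min lexx orbT.
    have [/existsP[p /andP[pj dp]]|nex] :=
        boolP [exists p, (p \in rpaths j) && (dem j <= f j p)].
      rewrite (bigD1 p)//= {1}/u /= pj (min_idPr dp) lerDl.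
      apply: sumr_ge0 => q /andP[qj _]; rewrite /u /= qj.
      by rewrite le_min (ff j).1// (ltW (dem_gt0 _)).
    rewrite (le_trans (ff j).2)// ler_sum// => p pj; rewrite /u /= pj le_min lexx/=.
    move/existsPn: nex => /(_ p); rewrite pj/= -ltNge => /ltW; exact: id.
  exists u => //; apply: ler_sum => e _.
  have u0 j p : p \in rpaths j -> 0 <= cur u j p by exact: (feasK _ Ku j).1.
  have uf j p : p \in rpaths j -> cur u j p <= f j p.
    by move=> pj; rewrite /cur /u /= pj ge_min lexx.
  rewrite ge0_ler_powR ?(ltW a0)// ?nnegrE ?load_ge0//.
    by move=> j p; exact: (ff j).1.
  by apply: ler_sum => j _; apply: ler_sum => p /andP[pj _]; exact: uf.
have K0 : K !=set0.
  have : feasible (fun (j : 'I_(nreq I)) (_ : {set edge (igraph I)}) => dem j).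
    move=> j; split=> [p _|]; first exact/ltW/dem_gt0.
    have /card_gt0P[p pj] := paths_gt0 j.
    rewrite (bigD1 p)//= lerDl; apply: sumr_ge0 => q _; exact/ltW/dem_gt0.
  by move=> /trunc[u Ku _]; exists u.
pose pw (u : X) : R := \sum_e Num.max (load (cur u) e) 0 `^ alpha.
have pwE u : K u -> pw u = power alpha (cur u).
  move=> /feasK fu; apply: eq_bigr => e _; rewrite (max_idPl _)//.
  by apply: load_ge0 => j; exact: (fu j).1.
have cpw : continuous pw.
  apply: continuous_bigsum => e u.
  apply: (@continuous_comp _ _ _ (fun u : X => load (cur u) e : R)
            (fun x : R => Num.max x 0 `^ alpha)).
    by apply: continuous_bigsum => j; apply: continuous_bigsum => p; exact: cproj.
  exact: continuous_powR_max0.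
have [u /set_mem Ku umin] := compact_EVT_min K0 cptK (continuous_subspaceT cpw).
have cu := feasK _ Ku.
exists (cur u) => //.
have lb : lbound [set power alpha f | f in @feasible _ I] (power alpha (cur u)).
  move=> _ [f ff <-]; have [v Kv /(le_trans _)] := trunc f ff; apply.
  by rewrite -!pwE//; apply: umin; exact/mem_set.
apply/eqP; rewrite eq_le; apply/andP; split.
  by apply: lb_le_inf => //; exists (power alpha (cur u)), (cur u).
by apply: ge_inf; [exists (power alpha (cur u))|exists (cur u)].
Qed.
End Attained.

(* Main.v *)
(* Greedy raises the total power at rate at most the current cost of every
   (s_j, t_j)-path q, hence, costs being nondecreasing, at most the cost C(q) of q
   under the final loads L. So request j raises the power by at most
   dem j * min_q C(q), which is at most the cost under C of the part of an optimal
   flow serving j. Summing over j gives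
     sum_e L_e^alpha <= sum_e alpha * L_e^(alpha - 1) * L*_e
   with L* the loads of the optimal flow, and Young's inequality applied to L_e
   and alpha * L*_e concludes. The greedy rule only speaks of almost every tau, so
   integrating the rate requires the fundamental theorem of calculus for
   nondecreasing Lipschitz functions; it comes from the Radon-Nikodym density of
   their Lebesgue-Stieltjes measure. *)
Require Import Defs.
From HB Require Import structures.
From mathcomp Require Import all_boot all_order all_algebra.
From mathcomp Require Import ring lra.
From mathcomp Require Import all_classical all_reals all_analysis.
Import Order.TTheory GRing.Theory Num.Theory.
Import numFieldNormedType.Exports.
Local Open Scope classical_set_scope.
Local Open Scope ring_scope.

(** * Real analysis: increments bounded through almost-everywhere derivatives, and Young's
    inequality *)

Lemma derive1_ge0_left (R : realType) (f : R -> R) (a c : R) : a < c ->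
  derivable f c 1 -> (forall t, a < t < c -> f t <= f c) -> 0 <= derive1 f c.
Proof.
move=> ac df fc.
have : (h^-1 *: (f (h + c) - f c)) @[h --> 0^'-] --> derive1 f c.
  apply: cvg_dnbhs_at_left; move: df => /cvg_ex[l].
  under eq_fun do rewrite /= scaler1.
  by rewrite /derive1 => /[dup] /cvg_lim ->.
move=> /cvgr_to_ge; apply.
near=> h.
have h0 : h < 0 by near: h; exact: nbhs_left_lt.
rewrite /GRing.scale/= nmulr_rge0 ?invr_lt0// subr_le0 fc//.
rewrite gtrDr h0 andbT -ltrBlDr.
by near: h; apply: nbhs_left_gt; rewrite subr_lt0.
Unshelve. all: by end_near. Qed.

Lemma lebesgue_stieltjes_measureE (R : realType) (H : cumulative R R) (x y : R) :
  x <= y -> lebesgue_stieltjes_measure H `]x, y] = (H y - H x)%:E.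
Proof.
move=> xy; rewrite /lebesgue_stieltjes_measure/= /measure_extension/=.
by rewrite measurable_mu_extE/= ?wlength_itv_bnd//; exact: is_ocitv.
Qed.

(* x |-> k x - H x is cumulative too, and the two measures add up to k times Lebesgue. *)
Lemma lebesgue_stieltjes_measure_dominates (R : realType) (H : cumulative R R) (k : R) :
  (forall x y, x <= y -> H y - H x <= k * (y - x)) ->
  lebesgue_stieltjes_measure H `<< @lebesgue_measure R.
Proof.
move=> Hk.
(* Any larger constant also bounds the increments; a positive one can be inverted to scale [nu]. *)
wlog k0 : k Hk / 0 < k.
  move=> /(_ (`|k| + 1)); apply; last by rewrite ltr_wpDl.
  move=> x y xy; rewrite (le_trans (Hk _ _ xy))// ler_wpM2r ?subr_ge0//.
  by rewrite (le_trans (ler_norm _))// lerDl.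
pose K0 x := k * x - H x.
have K0nd : {homo K0 : x y / x <= y}.
  by move=> x y /Hk; rewrite /K0; lra.
have K0c : right_continuous K0.
  move=> x; apply: cvgB; last exact: (cumulative_is_right_continuous H x).
  apply: cvgMr; exact: cvg_within.
pose K : cumulative R R := HB.pack K0 (isCumulative.Build R _ R K0 K0nd K0c).
have ki : 0 <= k^-1 by rewrite invr_ge0 ltW.
pose nu : {measure set (measurableTypeR R) -> \bar R} :=
  mscale (NngNum ki) (measure_add (lebesgue_stieltjes_measure H) (lebesgue_stieltjes_measure K)).
have nuE A : nu A = (k^-1%:E * (lebesgue_stieltjes_measure H A + lebesgue_stieltjes_measure K A))%E.
  by rewrite -[X in (_ * X)%E]measure_addE.
have lebE A : measurable A -> lebesgue_measure A = nu A.
  apply: lebesgue_measure_unique => X /ocitvP[->|[[x y]/= xy ->]].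
    by rewrite !measure0.
  rewrite nuE !lebesgue_stieltjes_measureE ?ltW//.
  rewrite [LHS]lebesgue_stieltjes_measureE ?ltW// /K /= /K0; congr EFin.
  by field; rewrite gt_eqF.
apply/null_content_dominatesP => A mA A0.
have /eqP : nu A = 0%E by exact: etrans (esym (lebE _ mA)) A0.
rewrite nuE mule_eq0 eqe invr_eq0 gt_eqF//=.
by rewrite padde_eq0 ?measure_ge0// => /andP[/eqP].
Qed.

(** The increment bounds make the Stieltjes measure of [h] on []a, b]] absolutely continuous. Its
    density is [phi], and differentiating the integral of [phi] with [FTC1] shows that [phi] is
    almost everywhere the derivative of [h]. *)
Lemma FTC2_monotone_lipschitz (R : realType) (h : R -> R) (a b k : R) : a < b ->
  (forall x y, a <= x -> x <= y -> y <= b -> 0 <= h y - h x <= k * (y - x)) ->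
  exists phi : R -> R, [/\ forall x, 0 <= phi x,
    lebesgue_measure.-integrable setT (EFin \o phi),
    {ae (@lebesgue_measure R), forall x : R, x \in `]a, b[ ->
      derivable h x 1 /\ derive1 h x = phi x} &
    h b - h a = \int[lebesgue_measure]_(t in `]a, b]) phi t].
Proof.
move=> ab hk.
(* Clamping to the interval is nondecreasing and 1-Lipschitz, so [h] composed with [c] is a
   cumulative function on the whole line, although [h] is controlled only between [a] and [b]. *)
pose c x := Num.max a (Num.min x b).
have cK x : a <= x <= b -> c x = x.
  by move=> /andP[ax xb]; rewrite /c (min_idPl xb) (max_idPr ax).
have ca x : a <= c x by rewrite /c le_max lexx.
have cb x : c x <= b by rewrite /c ge_max (ltW ab) ge_min lexx orbT.
have cle x y : x <= y -> c x <= c y.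
  by move=> xy; rewrite /c le_max2// le_min2.
have ccontr x y : x <= y -> c y - c x <= y - x.
  move=> xy; rewrite /c /Num.max /Num.min.
  by case: (ltP x b) => ?; case: (ltP y b) => ?; case: ltP => ?; case: ltP => ?; lra.
wlog k0 : k hk / 0 < k.
  move=> /(_ (`|k| + 1)); apply; last by rewrite ltr_wpDl.
  move=> x y ax xy yb; have /andP[-> /le_trans->//] := hk x y ax xy yb.
  by rewrite ler_wpM2r ?subr_ge0// (le_trans (ler_norm _))// lerDl.
pose H0 x := h (c x).
have H0k x y : x <= y -> 0 <= H0 y - H0 x <= k * (y - x).
  move=> xy; have /andP[-> /le_trans->//] := hk _ _ (ca x) (cle _ _ xy) (cb y).
  by rewrite ler_wpM2l ?ccontr// ltW.
have H0nd : {homo H0 : x y / x <= y}.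
  by move=> x y /H0k/andP[+ _]; rewrite subr_ge0.
have H0c : right_continuous H0.
  move=> x; apply/cvgrPdist_le => e e0; near=> y.
  have xy : x <= y by near: y; exact: nbhs_right_ge.
  have /andP[Hxy /le_trans Hk] := H0k _ _ xy.
  rewrite distrC ger0_norm// Hk// -ler_pdivlMl// lerBlDr.
  by near: y; apply: nbhs_right_le; rewrite ltrDr mulr_gt0// invr_gt0.
pose H : cumulative R R := HB.pack H0 (isCumulative.Build R _ R H0 H0nd H0c).
have mab : measurable (`]a, b] : set (measurableTypeR R)) by exact: measurable_itv.
have Hab : (lebesgue_stieltjes_measure H `]a, b] < +oo)%E.
  by rewrite lebesgue_stieltjes_measureE ?ltry// ltW.
(* Restricted to []a, b]] the measure is finite, so its density is integrable over the whole
   line. *)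
pose nu : {finite_measure set (measurableTypeR R) -> \bar R} := mfrestr mab Hab.
have nuE x : a <= x <= b -> nu `]a, x]%classic = (h x - h a)%:E.
  move=> /andP[ax xb]; rewrite /nu/= /mfrestr/= /mrestr.
  rewrite (_ : _ `&` _ = `]a, x]%classic); last first.
    by apply/setIidl; apply: subset_itvl; rewrite bnd_simp.
  rewrite lebesgue_stieltjes_measureE//= /H/= /H0.
  by rewrite !cK ?lexx ?(ltW ab) ?ax.
have nu_dom : nu `<< @lebesgue_measure R.
  have /null_content_dominatesP Hdom : lebesgue_stieltjes_measure H `<< @lebesgue_measure R.
    by apply: (@lebesgue_stieltjes_measure_dominates _ _ k) => x y /H0k/andP[].
  apply/null_content_dominatesP => A mA A0; apply: Hdom => /=.
    exact: measurableI.
  apply/eqP; rewrite eq_le measure_ge0 andbT -A0.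
  by apply: le_measure; rewrite ?inE//; exact: measurableI.
have [f [f0 ffin fint fE]] := radon_nikodym_sigma_finite nu_dom.
pose phi x := fine (f x).
have phiE : EFin \o phi = f by apply/funext => x; rewrite /= fineK.
exists phi.
have intphi : lebesgue_measure.-integrable setT (EFin \o phi) by rewrite phiE.
have hE x : a <= x <= b -> h x - h a = \int[lebesgue_measure]_(t in `]a, x]) phi t.
  move=> axb; rewrite /Rintegral (_ : integral _ _ _ = (h x - h a)%:E)//.
  rewrite -(nuE _ axb) fE; last exact: measurable_itv.
  by apply: eq_integral => t _; rewrite /phi fineK.
split => //; [by move=> x; exact: fine_ge0| |by apply: hE; rewrite lexx ltW].
have intxphi y : lebesgue_measure.-integrable [set` Interval (BRight a) (BRight y)] (EFin \o phi).
  exact: (integrableS measurableT).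
have locphi : locally_integrable [set: R] phi.
  by apply: open_integrable_locally => //; exact: openT.
pose F (y : R) := \int[lebesgue_measure]_(t in `]a, y]) phi t.
(* Near an interior point [h] is [F] plus the constant [h a], so differentiability passes from [F]
   to [h]. *)
have Fh (x : R) : a < x < b -> derivable F x 1 /\ derive1 F x = phi x ->
    derivable h x 1 /\ derive1 h x = phi x.
  move=> /andP[ax xb] [dF F'].
  have dF1 : is_derive x 1 (F + cst (h a)) (phi x + 0).
    by apply: is_deriveD; apply: DeriveDef => //; rewrite -derive1E.
  suff [dh dhE] : is_derive x 1 h (phi x + 0) by rewrite derive1E dhE addr0.
  apply: near_eq_is_derive dF1; near=> y.
  rewrite /GRing.add/= /cst/= /F -hE ?subrK//; apply/andP; split; apply/ltW.
    by near: y; exact: lt_nbhsr.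
  by near: y; exact: lt_nbhsl.
have := FTC1 intxphi locphi.
apply: filterS; first exact: (ae_filter_ringOfSetsType lebesgue_measure).
move=> x FTCx /[!in_itv]/= axb; apply: Fh => //.
by apply: FTCx; rewrite /= lte_fin; case/andP: axb.
Unshelve. all: by end_near. Qed.

(** A mean value inequality with an exceptional null set: the increment is the integral of a density
    that is almost everywhere the derivative. The Cantor function shows that monotonicity and
    continuity alone would not allow this. *)
Lemma derive1_le_increment_le (R : realType) (h : R -> R) (a b k m : R) :
  a < b -> 0 <= m ->
  (forall x y, a <= x -> x <= y -> y <= b -> 0 <= h y - h x <= k * (y - x)) ->
  {ae (@lebesgue_measure R), forall x : R, x \in `]a, b[ ->
    derivable h x 1 -> derive1 h x <= m} ->
  h b - h a <= m * (b - a).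
Proof.
move=> ab m0 /(FTC2_monotone_lipschitz _ _ _ _ _ ab)[phi [phi0 intphi dphi ->]] hm.
(* Dropping the endpoint [b] leaves the open interval on which the derivative is bounded. *)
rewrite -Rintegral_itv_bndo_bndc; last exact: (integrableS measurableT).
have muab : lebesgue_measure (`]a, b[%classic : set R) = (b - a)%:E.
  by rewrite lebesgue_measure_itv/= lte_fin ab.
rewrite -lee_fin /Rintegral fineK; last first.
  by apply: integrable_fin_num => //; exact: (integrableS measurableT).
rewrite EFinM -muab -integral_cst//.
apply: ae_ge0_le_integral => //.
- by move=> x _; rewrite lee_fin.
- by apply: (measurable_int lebesgue_measure); exact: (integrableS measurableT).
- apply: filterS2 dphi hm; first exact: (ae_filter_ringOfSetsType lebesgue_measure).
  move=> x dphi hm xab.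
  by have [dh <-] := dphi xab; rewrite lee_fin hm.
Qed.

(** Young's inequality with exponents [alpha / (alpha - 1)] and [alpha], multiplied by [alpha].
    Rearranged, it says that the graph of the power function lies above its tangent at [x]; it
    serves in this form for load increments, and directly in the final comparison. *)
Lemma powR_young (R : realType) (alpha x y : R) : 1 < alpha -> 0 <= x -> 0 <= y ->
  alpha * x `^ (alpha - 1) * y <= (alpha - 1) * x `^ alpha + y `^ alpha.
Proof.
move=> a1 x0 y0.
have a0 : 0 < alpha by lra.
have a10 : 0 < alpha - 1 by lra.
have pq : (alpha / (alpha - 1))^-1 + alpha^-1 = 1.
  by field; rewrite !gt_eqF.
have := conjugate_powR (powR_ge0 x (alpha - 1)) y0 (divr_gt0 a0 a10) a0 pq.
rewrite -powRrM (_ : _ * (alpha / _) = alpha); last by field; rewrite gt_eqF.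
rewrite -(ler_pM2l a0) mulrA => /le_trans; apply.
rewrite le_eqVlt; apply/orP; left; apply/eqP.
by field; rewrite !gt_eqF.
Qed.

Lemma is_derive_bigsum (R : realType) (J : finType) (P : pred J)
    (f : J -> R -> R) (df : J -> R) (x : R) :
  (forall i, P i -> is_derive x 1 (f i) (df i)) ->
  is_derive x 1 (fun t => \sum_(i | P i) f i t) (\sum_(i | P i) df i).
Proof.
move=> fdf; rewrite (_ : (fun _ => _) = \sum_(i | P i) f i); last first.
  by apply/funext => t; rewrite fct_sumE.
by elim/big_ind2 : _ => // *; [exact: is_derive_cst|exact: is_deriveD].
Qed.

(** * Growth of the power while a single request is routed *)

Section GreedyRun.
Context {R : realType} {I : instance R} {alpha : R} {g : schedule I}.
Context (alpha_gt1 : 1 < alpha) (g_greedy : greedy_run alpha g).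
Implicit Types (j : 'I_(nreq I)) (p q : {set edge (igraph I)}) (e : edge (igraph I)).

Lemma schedule_le j p x y : p \in rpaths j -> 0 <= x -> x <= y -> y <= dem j ->
  g j p x <= g j p y.
Proof.
move=> pj x0 xy yd; have [_ + _] := (let: And3 h _ _ := g_greedy j in h) p pj.
by apply=> //; rewrite in_itv/= ?x0 ?yd ?(le_trans xy)// (le_trans x0).
Qed.

Lemma schedule_ge0 j p x : p \in rpaths j -> 0 <= x -> x <= dem j -> 0 <= g j p x.
Proof.
move=> pj x0 xd; have [<- _ _] := (let: And3 h _ _ := g_greedy j in h) p pj.
exact: schedule_le.
Qed.

(** The increments on all paths are nonnegative and sum to [y - x]; hence each path has Lipschitz
    constant 1. *)
Lemma schedule_increment_le j p x y :
  p \in rpaths j -> 0 <= x -> x <= y -> y <= dem j ->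
  g j p y - g j p x <= y - x.
Proof.
move=> pj x0 xy yd; have [_ gsum _] := g_greedy j.
rewrite -[leRHS](_ : \sum_(q in rpaths j) (g j q y - g j q x) = _); last first.
  by rewrite sumrB !gsum// in_itv/= ?x0 ?yd ?(le_trans xy)// (le_trans x0).
rewrite (bigD1 p)//= lerDl sumr_ge0// => q /andP[qj _].
by rewrite subr_ge0 schedule_le.
Qed.

Lemma current_loadB j x y e : current_load g j y e - current_load g j x e =
  \sum_(p in rpaths j | e \in p) (g j p y - g j p x).
Proof. by rewrite sumrB /current_load; ring. Qed.

Lemma current_load_le j x y e : 0 <= x -> x <= y -> y <= dem j ->
  current_load g j x e <= current_load g j y e.
Proof.
move=> x0 xy yd; rewrite -subr_ge0 current_loadB sumr_ge0// => p /andP[pj _].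
by rewrite subr_ge0 schedule_le.
Qed.

Lemma final_flow_ge0 j p : p \in rpaths j -> 0 <= final_flow g j p.
Proof. by move=> pj; apply: schedule_ge0 => //; exact/ltW/dem_gt0. Qed.

Lemma current_load_ge0 j x e : 0 <= x -> x <= dem j -> 0 <= current_load g j x e.
Proof.
move=> x0 xd; rewrite addr_ge0 ?sumr_ge0// => [i _|p /andP[pj _]].
  by apply: sumr_ge0 => p /andP[pi _]; exact: final_flow_ge0.
exact: schedule_ge0.
Qed.

Lemma path_cost_ge0 j x p : 0 <= path_cost alpha g j x p.
Proof.
by apply: sumr_ge0 => e _; rewrite mulr_ge0 ?powR_ge0// ltW// (lt_trans ltr01).
Qed.

Lemma path_cost_le j x y p : 0 <= x -> x <= y -> y <= dem j ->
  path_cost alpha g j x p <= path_cost alpha g j y p.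
Proof.
move=> x0 xy yd; apply: ler_sum => e _.
rewrite ler_wpM2l ?ge0_ler_powR ?nnegrE ?current_load_le//.
- by rewrite ltW// (lt_trans ltr01).
- by rewrite subr_ge0 ltW.
- by rewrite current_load_ge0// (le_trans xy).
- by rewrite current_load_ge0// (le_trans x0).
Qed.

(** By convexity, the tangent at the load of time [t] bounds the change of power on each edge.
    Exchanging the sums over edges and paths collects the slopes into path costs. *)
Lemma current_power_increment_le j s t : 0 <= s <= dem j -> 0 <= t <= dem j ->
  \sum_e current_load g j t e `^ alpha - \sum_e current_load g j s e `^ alpha <=
  \sum_(p in rpaths j) path_cost alpha g j t p * (g j p t - g j p s).
Proof.
move=> /andP[s0 sd] /andP[t0 td]; rewrite -sumrB.
apply: (@le_trans _ _ (\sum_e alpha * current_load g j t e `^ (alpha - 1) *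
    (current_load g j t e - current_load g j s e))).
  apply: ler_sum => e _; set x := current_load _ _ t e.
  have x0 : 0 <= x by exact: current_load_ge0.
  have := powR_young R alpha x _ alpha_gt1 x0 (current_load_ge0 j s e s0 sd).
  have : x `^ alpha = x `^ (alpha - 1) * x.
    by rewrite mulrC mulr_powRB1// (lt_trans ltr01).
  nra.
under eq_bigr do rewrite current_loadB mulr_sumr.
under [leRHS]eq_bigr do rewrite mulr_suml.
rewrite (exchange_big_dep (fun p => p \in rpaths j))/=; last by move=> e p _ /andP[].
apply: ler_sum => p pj; rewrite le_eqVlt; apply/orP; left; apply/eqP.
by apply: eq_bigl => e; rewrite pj.
Qed.

(** The power is compared with a linear combination of the [g j p] whose coefficients are the costs
    at [x]. This avoids a chain rule, which is delicate on edges of load 0. *)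
Lemma current_power_derive1_le j q (x : R) :
  q \in rpaths j -> x \in `]0, dem j[ ->
  (forall p, p \in rpaths j -> derivable (g j p) x 1) ->
  (forall p, p \in rpaths j -> 0 < derive1 (g j p) x ->
    path_cost alpha g j x p <= path_cost alpha g j x q) ->
  derivable (fun t => \sum_e current_load g j t e `^ alpha) x 1 ->
  derive1 (fun t => \sum_e current_load g j t e `^ alpha) x <= path_cost alpha g j x q.
Proof.
move=> qj /[dup] xd /[!in_itv]/= /andP[x0 xdem] dg greedy dPhi.
have gdg p : p \in rpaths j -> is_derive x 1 (g j p) (derive1 (g j p) x).
  by move=> pj; rewrite derive1E; apply: DeriveDef => //; exact: dg.
have dg_ge0 p : p \in rpaths j -> 0 <= derive1 (g j p) x.
  move=> pj; apply: (@derive1_ge0_left _ _ 0) => //; first exact: dg.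
  by move=> t /andP[t0 tx]; apply: schedule_le => //; exact/ltW.
(* Near [x] the flows on all paths sum to the identity function, whose derivative is 1. *)
have sum_dg : \sum_(p in rpaths j) derive1 (g j p) x = 1.
  have [_ gsum _] := g_greedy j.
  have [_ <-] := is_derive_bigsum R _ (mem (rpaths j)) _ _ _ gdg.
  rewrite -[RHS](@derive_val _ _ _ x 1 id).
  apply: near_eq_derive; near=> t; apply: gsum; rewrite in_itv/=.
  apply/andP; split; apply/ltW.
    by near: t; exact: lt_nbhsr.
  by near: t; exact: lt_nbhsl.
set Phi := fun t : R => _ in dPhi *.
pose Psi := fun t : R => \sum_(p in rpaths j) path_cost alpha g j x p * g j p t.
have dPsi : is_derive x 1 Psi (\sum_(p in rpaths j)
    path_cost alpha g j x p * derive1 (g j p) x).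
  by apply: is_derive_bigsum => p pj; apply: is_deriveZ; exact: gdg.
have dPhi1 : is_derive x 1 Phi (derive1 Phi x).
  by rewrite derive1E; exact: DeriveDef.
have [dPP PPE] := is_deriveB dPsi dPhi1.
(* By convexity Psi - Phi has a maximum at x. *)
have : 0 <= derive1 (Psi - Phi) x.
  apply: (@derive1_ge0_left _ _ 0) => // t /andP[t0 tx]; rewrite -subr_ge0.
  have tin : 0 <= t <= dem j by rewrite !ltW// (lt_trans tx).
  have xin : 0 <= x <= dem j by rewrite !ltW.
  have := current_power_increment_le j t x tin xin.
  under [X in _ <= X -> _]eq_bigr do rewrite mulrBr.
  have PPz z : (Psi - Phi) z = Psi z - Phi z by [].
  by rewrite sumrB !PPz -/(Psi x) -/(Psi t) -/(Phi x) -/(Phi t); lra.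
rewrite derive1E PPE subr_ge0 => /le_trans; apply.
(* The rates are weights of total 1, and every path of positive weight costs at most as much as
   [q]. *)
rewrite -[leRHS]mulr1 -sum_dg mulr_sumr; apply: ler_sum => p pj.
have [dgp|dgp] := ltP 0 (derive1 (g j p) x).
  by rewrite ler_wpM2r ?dg_ge0 ?greedy.
by rewrite (_ : derive1 _ _ = 0) ?mulr0//; apply/eqP; rewrite eq_le dgp dg_ge0.
Unshelve. all: by end_near. Qed.

(** The rate bound involves the cost of [q] at the running time; raising it to the cost at time
    [dem j] gives a constant that the mean value inequality accepts. *)
Lemma greedy_power_increment_le j q : q \in rpaths j ->
  \sum_e current_load g j (dem j) e `^ alpha - \sum_e current_load g j 0 e `^ alpha <=
  path_cost alpha g j (dem j) q * dem j.
Proof.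
move=> qj; rewrite -[X in _ <= _ * X]subr0.
(* The sum of all path costs at the end is a crude Lipschitz constant: each path gains at most the
   elapsed amount, at no more than its final cost. *)
apply: (@derive1_le_increment_le _ (fun t => \sum_e current_load g j t e `^ alpha) 0
  (dem j) (\sum_(p in rpaths j) path_cost alpha g j (dem j) p)).
- exact: dem_gt0.
- exact: path_cost_ge0.
- move=> x y x0 xy yd; apply/andP; split.
    rewrite -sumrB sumr_ge0// => e _; rewrite subr_ge0.
    rewrite ge0_ler_powR ?nnegrE ?current_load_le//.
    + by rewrite ltW// (lt_trans ltr01).
    + by rewrite current_load_ge0// (le_trans xy).
    + by rewrite current_load_ge0// (le_trans x0).
  rewrite (le_trans (current_power_increment_le _ _ _ _ _))//.
  + by rewrite x0 (le_trans xy).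
  + by rewrite yd (le_trans x0).
  rewrite mulr_suml; apply: ler_sum => p pj.
  by rewrite ler_pM ?path_cost_ge0 ?path_cost_le ?subr_ge0 ?schedule_le
    ?schedule_increment_le// (le_trans x0).
(* The greedy rule speaks only of derivable schedules. The exceptional points of finitely many paths
   still form a null set. *)
- have dg : {ae (@lebesgue_measure R), forall x : R, x \in `]0, dem j[ ->
      forall p, p \in rpaths j -> derivable (g j p) x 1}.
    have ae_filter := ae_filter_ringOfSetsType (@lebesgue_measure R).
    have dgp p : {ae (@lebesgue_measure R), forall x : R,
        p \in rpaths j -> x \in `]0, dem j[ -> derivable (g j p) x 1}.
      have [pj|pj] := boolP (p \in rpaths j); last exact: nearW.
      have [x y x0 xy yd|phi [_ _ dphi _]] :=
          FTC2_monotone_lipschitz _ (g j p) 0 (dem j) 1 (dem_gt0 j).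
        by rewrite subr_ge0 schedule_le//= mul1r schedule_increment_le.
      by apply: filterS dphi => x dphi _ /dphi[].
    apply: filterS (@filter_forall _ _ _ _ ae_filter dgp) => x dgx xd p pj.
    exact: dgx.
  have [_ _ greedy] := g_greedy j.
  apply: filterS2 dg greedy.
    exact: (ae_filter_ringOfSetsType lebesgue_measure).
  move=> x dg greedy xd dPhi.
  have /[!in_itv]/= /andP[x0 xdem] := xd.
  rewrite (le_trans (current_power_derive1_le j q x _ _ _ _ _))//.
  + exact: dg.
  + by move=> p pj dp; exact: (greedy xd p pj (dg xd p pj) dp).
  + by rewrite path_cost_le// ltW.
Qed.

(** * Summation over the requests and comparison with a feasible flow *)

Definition load_before (n : nat) e : R :=
  \sum_(i < nreq I | (i < n)%N) \sum_(p in rpaths i | e \in p) final_flow g i p.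

Lemma current_load_dem j e : current_load g j (dem j) e = load_before j.+1 e.
Proof.
rewrite /current_load /load_before [RHS](bigD1 j)//= addrC; congr (_ + _).
by apply: eq_bigl => i; rewrite ltnS ltn_neqAle andbC.
Qed.

Lemma current_load0 j e : current_load g j 0 e = load_before j e.
Proof.
rewrite /current_load [X in _ + X]big1 ?addr0// => p /andP[pj _].
by have [] := (let: And3 h _ _ := g_greedy j in h) p pj.
Qed.

Lemma load_before_le n e : load_before n e <= load (final_flow g) e.
Proof.
rewrite /load (bigID (fun i : 'I_(nreq I) => (i < n)%N))/= lerDl.
by apply: sumr_ge0 => i _; apply: sumr_ge0 => p /andP[pi _]; exact: final_flow_ge0.
Qed.

Definition final_cost p : R :=
  \sum_(e in p) alpha * load (final_flow g) e `^ (alpha - 1).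

Lemma path_cost_dem_le j p : path_cost alpha g j (dem j) p <= final_cost p.
Proof.
have d0 := ltW (dem_gt0 j).
apply: ler_sum => e _; rewrite ler_wpM2l//; first by rewrite ltW// (lt_trans ltr01).
rewrite ge0_ler_powR ?nnegrE ?current_load_ge0//.
- by rewrite subr_ge0 ltW.
- by apply: load_ge0 => i q; exact: final_flow_ge0.
- by rewrite current_load_dem load_before_le.
Qed.

(** Instead of choosing a cheapest path, the bound by [dem j] times the cost is averaged over all
    paths with the weights [f j p], whose total is at least [dem j]. *)
Lemma power_increment_le_cost (f : flow I) j : feasible f ->
  \sum_e load_before j.+1 e `^ alpha - \sum_e load_before j e `^ alpha <=
  \sum_(p in rpaths j) f j p * final_cost p.
Proof.
move=> /(_ j)[f0 fdem]; set D := _ - _.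
have Dq q : q \in rpaths j -> D <= final_cost q * dem j.
  move=> qj; have := greedy_power_increment_le j q qj.
  under eq_bigr do rewrite current_load_dem.
  under [X in _ - X]eq_bigr do rewrite current_load0.
  by move=> /le_trans; apply; rewrite ler_wpM2r ?path_cost_dem_le// ltW ?dem_gt0.
have cost0 p : 0 <= final_cost p.
  by apply: sumr_ge0 => e _; rewrite mulr_ge0 ?powR_ge0// ltW// (lt_trans ltr01).
(* The flow [f] may exceed the demand, so multiplying [fdem] by [D] needs the sign of [D]; a
   nonpositive [D] is below the nonnegative right-hand side. *)
have [D0|D0] := leP D 0.
  rewrite (le_trans D0)// sumr_ge0// => p pj.
  by rewrite mulr_ge0 ?f0.
rewrite -(ler_pM2r (dem_gt0 j)).
rewrite (le_trans (ler_wpM2l (ltW D0) fdem))// mulr_sumr mulr_suml.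
apply: ler_sum => p pj; rewrite mulrC -mulrA.
by rewrite ler_wpM2l ?f0 ?Dq.
Qed.

Lemma power_final_flow_le (f : flow I) : feasible f ->
  power alpha (final_flow g) <=
  \sum_e alpha * load (final_flow g) e `^ (alpha - 1) * load f e.
Proof.
move=> ff.
(* Telescoping over the requests: indexing [load_before] by [nat] lets [n] run from 0, where all
   loads and hence all powers vanish, to [nreq I], where the loads are final. *)
have le_n n : (n <= nreq I)%N -> \sum_e load_before n e `^ alpha <=
    \sum_(j < nreq I | (j < n)%N) \sum_(p in rpaths j) f j p * final_cost p.
  elim: n => [_|n IHn nI].
    rewrite big1 ?big1// => e _.
    by rewrite /load_before big1// powR0// gt_eqF// (lt_trans ltr01).
  pose j := Ordinal nI.
  rewrite (bigD1 j)//= (eq_bigl (fun i : 'I_(nreq I) => (i < n)%N)); last first.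
    by move=> i; rewrite ltnS ltn_neqAle andbC.
  rewrite -lerBlDr; apply: (le_trans _ (power_increment_le_cost f j ff)).
  by rewrite lerD2l lerN2 IHn// ltnW.
have := le_n (nreq I) (leqnn _).
rewrite (eq_bigr (fun e => load (final_flow g) e `^ alpha)); last first.
  by move=> e _; congr (_ `^ _); apply: eq_bigl => i; exact: ltn_ord.
(* Both sides agree: summing the cost of each path weighted by [f] is summing, over edges, the edge
   cost times the load of [f]. *)
move=> /le_trans; apply; rewrite le_eqVlt; apply/orP; left; apply/eqP.
rewrite (eq_bigl xpredT); last by move=> i; exact: ltn_ord.
under [RHS]eq_bigr do rewrite mulr_sumr.
rewrite [RHS]exchange_big/=; apply: eq_bigr => j _.
under [RHS]eq_bigr do rewrite mulr_sumr.
rewrite (exchange_big_dep (fun p => p \in rpaths j))/=; last by move=> e p _ /andP[].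
apply: eq_bigr => p pj; rewrite mulr_sumr.
by apply: eq_big => [e|e _]; [rewrite pj|exact: mulrC].
Qed.

End GreedyRun.

Theorem theorem4p4 (R : realType) (alpha : R) (alpha_gt1 : 1 < alpha)
    (I : instance R) (g : schedule I) (g_greedy : greedy_run alpha g) :
  power alpha (final_flow g) <= alpha `^ alpha * OPT I alpha.
Proof.
have a0 : 0 < alpha by exact: lt_trans alpha_gt1.
have [f ff <-] := OPT_attained I a0.
have L0 e : 0 <= load (final_flow g) e.
  by apply: load_ge0 => j p; exact: (final_flow_ge0 g_greedy).
have f0 e : 0 <= load f e by apply: load_ge0 => j p; exact: (ff j).1.
have young : alpha * (\sum_e alpha * load (final_flow g) e `^ (alpha - 1) * load f e) <=
    (alpha - 1) * power alpha (final_flow g) + alpha `^ alpha * power alpha f.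
  rewrite /power !mulr_sumr -big_split/=; apply: ler_sum => e _.
  (* Taking [alpha * load f e] as second argument produces the factor [alpha] on the left and,
     through [powRM], the constant of the theorem on the right. *)
  have := powR_young R alpha _ _ alpha_gt1 (L0 e) (mulr_ge0 (ltW a0) (f0 e)).
  by rewrite powRM ?(ltW a0)//; lra.
have := power_final_flow_le alpha_gt1 g_greedy f ff.
by move=> /(ler_wpM2l (ltW a0)) /le_trans/(_ young); lra.
Qed.
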